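(* Let $A$ be a random matrix in $\mathbb{R}^{n\times n}$, let $\mathcal{C}\subset\mathbb{R}^{n\times n}$, let $Z^*\in\operatorname{argmax}_{Z\in\mathcal{C}}\langle \mathbb{E}A,Z\rangle$ and $\hat Z\in\operatorname{argmax}_{Z\in\mathcal{C}}\langle A,Z\rangle$, and let $G:\mathbb{R}^{n\times n}\to\mathbb{R}$. Assume that $\mathcal{C}$ is star-shaped in $Z^*$ and that, for some $0<\Delta<1$, the following local curvature assumption holds: for all $Z\in\mathcal{C}$, if $G(Z^*-Z)\le r^*_G(\Delta)$ then $\langle\mathbb{E}A,Z^*-Z\rangle\ge G(Z^*-Z)$. Assume moreover that $G$ is continuous, $G(0)=0$, and $G(\lambda(Z^*-Z))\le\lambda G(Z^*-Z)$ for all $\lambda\in[0,1]$ and all $Z\in\mathcal{C}$. Then, with probability at least $1-\Delta$, $G(Z^*-\hat Z)\le r^*_G(\Delta)$.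
   Context: $\langle A,B\rangle=\sum_{i,j}A_{ij}B_{ij}$ for real matrices. The set $\mathcal{C}$ is star-shaped in $Z^*$ if for all $Z\in\mathcal{C}$ the segment $[Z,Z^*]$ is contained in $\mathcal{C}$. The maximizers $Z^*$ and $\hat Z$ are assumed to exist. For $0<\Delta<1$, $$r^*_G(\Delta)=\inf\left(r>0:\ \mathbb{P}\left[\sup_{Z\in\mathcal{C}:\ G(Z^*-Z)\le r}\langle A-\mathbb{E}A,Z-Z^*\rangle\le \tfrac12 r\right]\ge 1-\Delta\right).$$
   Formalization: The formal statement additionally assumes r*_G(Δ) > 0 (the value +∞ is allowed); without it the claim fails, e.g. n=1, A=0, C=ℝ, Z*=0, Ẑ=1, G=|·|, where r*_G(Δ)=0 but G(Z*−Ẑ)=1. *)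

(* Defs.v *)
From HB Require Import structures.
From mathcomp Require Import all_boot all_order all_algebra.
From mathcomp Require Import all_classical all_reals all_analysis.

Set Implicit Arguments.
Unset Strict Implicit.
Unset Printing Implicit Defensive.

Import Order.TTheory GRing.Theory Num.Theory.
Import numFieldNormedType.Exports.

Local Open Scope classical_set_scope.
Local Open Scope ring_scope.

Definition mxdot (R : realType) (n : nat) (A B : 'M[R]_n) : R :=
  \sum_(i < n) \sum_(j < n) A i j * B i j.

(* Integrability of the entries makes them real random variables and makes
   the entrywise expectation below finite. *)
Definition integrable_mx (d : measure_display) (T : measurableType d)
    (R : realType) (P : probability T R) (n : nat) (A : T -> 'M[R]_n) : Prop :=
  forall i j : 'I_n, P.-integrable [set: T] (fun w => (A w i j)%:E).

Definition expectation_mx (d : measure_display) (T : measurableType d)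
    (R : realType) (P : probability T R) (n : nat) (A : T -> 'M[R]_n) : 'M[R]_n :=
  \matrix_(i < n, j < n) fine (expectation P (fun w => A w i j)).

Definition is_argmax (X : Type) (R : realType) (C : set X) (f : X -> R)
    (x : X) : Prop :=
  C x /\ forall y, C y -> f y <= f x.

Definition star_shaped_in (R : realType) (n : nat) (C : set 'M[R]_n)
    (Zs : 'M[R]_n) : Prop :=
  forall Z, C Z -> forall t : R, 0 <= t <= 1 -> C ((1 - t) *: Z + t *: Zs).

(* The supremum over Z in C with G (Zs - Z) <= r of <W, Z - Zs>, as an
   extended real since C need not be bounded. *)
Definition local_sup (R : realType) (n : nat) (C : set 'M[R]_n) (Zs : 'M[R]_n)
    (G : 'M[R]_n -> R) (r : R) (W : 'M[R]_n) : \bar R :=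
  ereal_sup [set (mxdot W (Z - Zs))%:E | Z in [set Z | C Z /\ G (Zs - Z) <= r]].

(* The infimum is taken in the extended reals: it is +oo if no radius is
   admissible.  The event is measurable when the entries of [A] are: it is the
   preimage by [A] of an intersection of closed half-spaces. *)
Definition rstar (d : measure_display) (T : measurableType d)
    (R : realType) (P : probability T R) (n : nat) (A : T -> 'M[R]_n)
    (C : set 'M[R]_n) (Zs : 'M[R]_n) (G : 'M[R]_n -> R) (delta : R) : \bar R :=
  ereal_inf [set r%:E | r in [set r : R | 0 < r /\
    ((1 - delta)%:E <=
      P [set w | local_sup C Zs G r (A w - expectation_mx P A)%R
                 <= (r / 2)%:E])%E ]].

(* For measurable [E] this is [p%:E <= P E]; the form below also makes sense
   for events defined through a maximizer that is not chosen measurably. *)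
Definition holds_with_probability_at_least (d : measure_display)
    (T : measurableType d) (R : realType) (P : probability T R) (p : R)
    (E : set T) : Prop :=
  exists F : set T, [/\ measurable F, F `<=` E & (p%:E <= P F)%E].

(* Main.v *)
Require Import Defs.
From HB Require Import structures.
From mathcomp Require Import all_boot all_order all_algebra.
From mathcomp Require Import all_classical all_reals all_analysis.
From mathcomp Require Import measurable_realfun lra.

(** Write [EA] for the expectation of [A] and [r] for [rstar].  Scaling towards
    [Zs] shows that the event [E s], on which [<A - EA, Z - Zs>] is at most [s/2]
    over the [Z] in [C] with [G (Zs - Z) <= s], grows with [s]; as [E r] is the
    intersection of the [E s] for [s > r], continuity from above gives it
    probability at least [1 - delta].  On [E r], if [G (Zs - hatZ) > r] then the
    intermediate value theorem yields a point [Z] of [C] on the segment from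
    [Zs] to [hatZ] with [G (Zs - Z) = r].  There
    [<A, Z - Zs> <= r/2 + <EA, Z - Zs> <= r/2 - r < 0], so by linearity
    [<A, hatZ - Zs> < 0], contradicting the maximality of [hatZ]. *)

Set Implicit Arguments.
Unset Strict Implicit.
Unset Printing Implicit Defensive.

Import Order.TTheory GRing.Theory Num.Theory.
Import numFieldNormedType.Exports.

Local Open Scope classical_set_scope.
Local Open Scope ring_scope.

(** * Bilinearity and continuity of the matrix inner product *)

Lemma mxdotBl (R : realType) n (A B Z : 'M[R]_n) :
  mxdot (A - B) Z = mxdot A Z - mxdot B Z.
Proof.
rewrite /mxdot -sumrB; apply: eq_bigr => i _; rewrite -sumrB.
by apply: eq_bigr => j _; rewrite !mxE mulrBl.
Qed.

Lemma mxdotZr (R : realType) n (A Z : 'M[R]_n) (a : R) :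
  mxdot A (a *: Z) = a * mxdot A Z.
Proof.
rewrite /mxdot mulr_sumr; apply: eq_bigr => i _; rewrite mulr_sumr.
by apply: eq_bigr => j _; rewrite !mxE mulrCA.
Qed.

Lemma mxdotBr (R : realType) n (A Y Z : 'M[R]_n) :
  mxdot A (Y - Z) = mxdot A Y - mxdot A Z.
Proof.
rewrite /mxdot -sumrB; apply: eq_bigr => i _; rewrite -sumrB.
by apply: eq_bigr => j _; rewrite !mxE mulrBr.
Qed.

Lemma mxdot_continuousl (R : realType) n (Z : 'M[R]_n) :
  continuous (fun W => mxdot W Z).
Proof.
move=> W; rewrite /mxdot; have nbhsW := nbhs_filter W.
apply: (cvg_big add_continuous) => i _.
apply: (cvg_big add_continuous) => j _.
by apply: cvgM; [exact: coord_continuous | exact: cvg_cst].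
Qed.

(** * Measurability of open events for a random matrix *)

Lemma mx_rat_ball (R : realType) m n (U : set 'M[R]_(m, n)) (M : 'M[R]_(m, n)) :
  open U -> U M ->
  exists (Q : 'M[rat]_(m, n)) (k : nat),
    ball (map_mx ratr Q : 'M[R]_(m, n)) k.+1%:R^-1 `<=` U /\
    ball (map_mx ratr Q : 'M[R]_(m, n)) k.+1%:R^-1 M.
Proof.
move=> oU UM.
have /nbhs_ballP[e /= e0 eU] : nbhs M U by exact: open_nbhs_nbhs.
(* The radius is taken below [e / 2] so that a ball of that radius containing [M] has diameter less
   than [e] and stays in [U]. *)
have e20 : 0 < e / 2 by rewrite divr_gt0.
have [k ke] : exists k : nat, k.+1%:R^-1 < e / 2.
  by have [k _ /(_ _ (leqnn k))] := near_infty_natSinv_lt (PosNum e20); exists k.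
have k0 : 0 < k.+1%:R^-1 :> R by rewrite invr_gt0.
have approx (ij : 'I_m * 'I_n) :
    exists q : rat, ball (ratr q : R) k.+1%:R^-1 (M ij.1 ij.2).
  have [|q] := @rat_in_itvoo R (M ij.1 ij.2 - k.+1%:R^-1)
      (M ij.1 ij.2 + k.+1%:R^-1).
    by rewrite ltrD2l gtrN.
  rewrite in_itv /= => /andP[q1 q2]; exists q.
  by rewrite /ball /= distrC ltr_distlC q1.
have [q qM] := choice approx.
pose Q := \matrix_(i, j) q (i, j).
have QM : ball (map_mx ratr Q : 'M[R]_(m, n)) k.+1%:R^-1 M.
  by split=> // i j; rewrite !mxE; exact: qM (i, j).
exists Q, k; split=> // N QN.
apply/eU/(@le_ball _ _ M (k.+1%:R^-1 + k.+1%:R^-1)); last first.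
  exact: ball_triangle (ball_sym QM) QN.
by rewrite [e]splitr lerD // ltW.
Qed.

Lemma measurable_mx_preimage_ball (R : realType) d (T : measurableType d) m n
    (W : T -> 'M[R]_(m, n)) (M : 'M[R]_(m, n)) (e : R) :
  (forall i j, measurable_fun [set: T] (fun w => W w i j)) ->
  measurable (W @^-1` ball M e).
Proof.
(* Membership in a matrix ball includes the condition [0 < e], so a nonpositive radius gives the
   empty set even for matrices without entries. *)
move=> mW; have [e0|e0] := ltP 0 e; last first.
  rewrite [X in measurable X](_ : _ = set0) //.
  by apply/seteqP; split=> // w -[]; rewrite ltNge e0.
rewrite [X in measurable X](_ : _ = \bigcap_(ij : 'I_m * 'I_n)
    ((fun w => W w ij.1 ij.2) @^-1` ball (M ij.1 ij.2) e)).
  apply: fin_bigcap_measurable => [|ij _]; first exact: finite_finset.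
  rewrite -[X in measurable X]setTI; apply: mW => //.
  exact: measurable_ball.
apply/seteqP; split=> w /= WB; first by move=> ij _; exact: WB.2.
by split=> // i j; exact: (WB (i, j)).
Qed.

(** An open set is the union of the balls with rational centre and radius [1/(k+1)] that it
    contains; there are countably many of them, and each has a measurable preimage. *)
Lemma measurable_mx_preimage_open (R : realType) d (T : measurableType d) m n
    (W : T -> 'M[R]_(m, n)) (U : set 'M[R]_(m, n)) :
  (forall i j, measurable_fun [set: T] (fun w => W w i j)) ->
  open U -> measurable (W @^-1` U).
Proof.
move=> mW oU.
pose I : set ('M[rat]_(m, n) * nat) :=
  [set x | ball (map_mx ratr x.1 : 'M[R]_(m, n)) x.2.+1%:R^-1 `<=` U].
rewrite [X in measurable X](_ : _ = \bigcup_(x in I)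
    W @^-1` ball (map_mx ratr x.1 : 'M[R]_(m, n)) x.2.+1%:R^-1).
  rewrite bigcup_mkcond; apply: countable_bigcupT_measurable => // x.
  by case: ifP => // _; exact: measurable_mx_preimage_ball.
apply/seteqP; split=> w /=.
  move=> /(mx_rat_ball oU)[Q [k [QU QW]]].
  by exists (Q, k).
by move=> [x xU] /xU.
Qed.

(** * The localized supremum and the deterministic argument *)

Section LocalSup.
Context (R : realType) (n : nat) (C : set 'M[R]_n) (Zs : 'M[R]_n).
Context (G : 'M[R]_n -> R).

Lemma local_sup_leP (r c : R) (W : 'M[R]_n) :
  (local_sup C Zs G r W <= c%:E)%E <->
  forall Z, C Z -> G (Zs - Z) <= r -> mxdot W (Z - Zs) <= c.
Proof.
split=> [supc Z CZ Zr|Wc].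
  by rewrite -lee_fin; apply: le_trans supc; apply: ereal_sup_ubound; exists Z.
by apply: ge_ereal_sup => _ [Z [CZ Zr] <-]; rewrite lee_fin Wc.
Qed.

(** The set of [Z] may be uncountable, so a countable intersection of half-space events is not at
    hand. The complement is instead the preimage of a union of open half-spaces, which is open. *)
Lemma measurable_local_sup_le d (T : measurableType d) (W : T -> 'M[R]_n)
    (r c : R) :
  (forall i j, measurable_fun [set: T] (fun w => W w i j)) ->
  measurable [set w | (local_sup C Zs G r (W w) <= c%:E)%E].
Proof.
move=> mW.
rewrite [X in measurable X](_ : _ = ~` (W @^-1`
    \bigcup_(Z in [set Z | C Z /\ G (Zs - Z) <= r])
      (fun M => mxdot M (Z - Zs)) @^-1` [set x | c < x])).
  apply: measurableC; apply: measurable_mx_preimage_open => //.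
  apply: bigcup_open => Z _; apply: open_comp; last exact: open_gt.
  by move=> M _; exact: mxdot_continuousl.
apply/seteqP; split=> w /=.
  by move=> /local_sup_leP Wc [Z [CZ Zr]] /=; rewrite ltNge Wc.
move=> Wc; apply/local_sup_leP => Z CZ Zr; rewrite leNgt; apply/negP => cZ.
by apply: Wc; exists Z.
Qed.

Hypothesis C_star : star_shaped_in C Zs.

Lemma star_shaped_shrink (l : R) Z : 0 <= l <= 1 -> C Z ->
  C (Zs - l *: (Zs - Z)).
Proof.
move=> /andP[l0 l1] CZ.
have -> : Zs - l *: (Zs - Z) = (1 - (1 - l)) *: Z + (1 - l) *: Zs.
  by rewrite subKr scalerBr opprB scalerBl scale1r addrCA.
by apply: C_star => //; rewrite subr_ge0 l1 gerBl.
Qed.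

Hypothesis G_scale : forall l : R, 0 <= l <= 1 -> forall Z, C Z ->
  G (l *: (Zs - Z)) <= l * G (Zs - Z).

Lemma local_sup_half_mono (r s : R) (W : 'M[R]_n) : 0 < r -> r <= s ->
  (local_sup C Zs G r W <= (r / 2)%:E)%E ->
  (local_sup C Zs G s W <= (s / 2)%:E)%E.
Proof.
move=> r0 rs /local_sup_leP Wr; apply/local_sup_leP => Z CZ Zs_le.
have s0 : 0 < s by exact: lt_le_trans rs.
(* Shrinking by [r / s] brings [Z] from radius [s] to radius [r] and multiplies both the inner
   product and the bound [s / 2] by [r / s]. *)
have l0 : 0 < r / s by rewrite divr_gt0.
have l01 : 0 <= r / s <= 1 by rewrite ltW //= ler_pdivrMr // mul1r.
have := Wr _ (star_shaped_shrink l01 CZ).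
rewrite subKr [_ - _ - Zs]addrAC subrr sub0r -scalerN opprB mxdotZr => Wl.
rewrite -(ler_pM2l l0) [leRHS]mulrA divfK ?gt_eqF //; apply: Wl.
apply: (le_trans (G_scale l01 CZ)).
by rewrite -[leRHS](@divfK _ s) ?gt_eqF // ler_pM2l.
Qed.

Hypothesis G_continuous : continuous G.
Hypothesis G0 : G 0 = 0.

Lemma curvature_argmax_le (EA A Zhat : 'M[R]_n) (r : R) : 0 < r ->
  (forall Z, C Z -> G (Zs - Z) <= r -> G (Zs - Z) <= mxdot EA (Zs - Z)) ->
  is_argmax C (mxdot A) Zhat ->
  C Zs ->
  (local_sup C Zs G r (A - EA) <= (r / 2)%:E)%E ->
  G (Zs - Zhat) <= r.
Proof.
move=> r0 curv [CZhat Zhat_max] CZs /local_sup_leP supr.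
rewrite leNgt; apply/negP => rG.
have Gl_cont : continuous (G \o (fun l : R => l *: (Zs - Zhat))).
  move=> l; apply: continuous_comp; first exact: scalel_continuous.
  exact: G_continuous.
have [|||l l01 /= Gl] := @IVT R (G \o (fun l : R => l *: (Zs - Zhat))) 0 1 r.
- exact: ler01.
- exact: continuous_subspaceT.
- by rewrite /= scale0r scale1r G0 ge_min le_max (ltW r0) (ltW rG) orbT.
rewrite in_itv /= in l01.
(* At [l = 0] the value of [G] would be 0 and not [r]. *)
have l0 : 0 < l.
  rewrite lt_def (andP l01).1 andbT; apply: contra_eq_neq Gl => ->.
  by rewrite scale0r G0 lt_eqF.
have CZ := star_shaped_shrink l01 CZhat.
have := curv _ CZ; have := supr _ CZ.
rewrite subKr [_ - _ - Zs]addrAC subrr sub0r Gl lexx => /(_ isT) sup1 /(_ isT).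
move: sup1; rewrite -scalerN opprB mxdotBl !mxdotZr.
rewrite -(opprB Zs) -scaleN1r !mxdotZr !mulN1r mxdotBr mxdotBr => sup1 EA1.
have := Zhat_max _ CZs; rewrite -subr_le0 => A1.
(* Maximality makes this product nonpositive, whereas [sup1] and [EA1] together bound it below by
   [r / 2]. *)
have : l * (mxdot A Zs - mxdot A Zhat) <= 0 by rewrite pmulr_rle0.
lra.
Qed.

End LocalSup.

(** * Admissibility of the infimum itself *)

Section RstarAttained.
Context (R : realType) (d : measure_display) (T : measurableType d).
Context (P : probability T R) (n : nat) (A : T -> 'M[R]_n).
Hypothesis A_integrable : integrable_mx P A.

Lemma measurable_centered_entry (i j : 'I_n) :
  measurable_fun [set: T] (fun w => (A w - expectation_mx P A) i j).
Proof.
have -> : (fun w => (A w - expectation_mx P A) i j) =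
    (fun w => A w i j) \- cst (expectation_mx P A i j).
  by apply/funext => w; rewrite !mxE.
apply: measurable_funB => //; apply/measurable_EFinP.
exact: measurable_int (A_integrable i j).
Qed.

Lemma rstar_attained (C : set 'M[R]_n) (Zs : 'M[R]_n) (G : 'M[R]_n -> R)
    (delta r : R) :
  star_shaped_in C Zs ->
  (forall l : R, 0 <= l <= 1 -> forall Z, C Z ->
    G (l *: (Zs - Z)) <= l * G (Zs - Z)) ->
  0 < r -> rstar P A C Zs G delta = r%:E ->
  ((1 - delta)%:E <=
    P [set w | local_sup C Zs G r (A w - expectation_mx P A)%R
                <= (r / 2)%:E])%E.
Proof.
move=> C_star G_scale r0 rE.
pose E s := [set w |
  (local_sup C Zs G s (A w - expectation_mx P A)%R <= (s / 2)%:E)%E].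
rewrite -/(E r).
have mE s : measurable (E s).
  exact/measurable_local_sup_le/measurable_centered_entry.
have E_mono (s t : R) : 0 < s -> s <= t -> E s `<=` E t.
  by move=> s0 st w; exact: local_sup_half_mono.
(* Any [s] above the infimum exceeds some admissible [t], and monotonicity carries the bound from
   [E t] to [E s]. *)
have PE s : r < s -> ((1 - delta)%:E <= P (E s))%E.
  rewrite -lte_fin -rE => /ereal_inf_lt[_ [t [t0 Pt] <-]].
  rewrite lte_fin => /ltW ts; apply: (le_trans Pt).
  by apply: le_measure (E_mono _ _ t0 ts); rewrite inE; exact: mE.
pose F k := E (r + k.+1%:R^-1).
have FE : \bigcap_k F k = E r.
  apply/seteqP; split=> w; last first.
    by move=> Ew k _; apply: E_mono Ew; rewrite // lerDl invr_ge0.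
  move=> Fw; apply/local_sup_leP => Z CZ Zr.
  (* A [Z] within radius [r] is also within [r + 1/(k+1)], so [F k] bounds its inner product by
     [(r + 1/(k+1)) / 2], which tends to [r / 2]. *)
  suff le_e (e : R) : 0 < e ->
      mxdot (A w - expectation_mx P A) (Z - Zs) <= r / 2 + e.
    exact/ler_addgt0Pr.
  move=> e0.
  have [k ke] : exists k : nat, k.+1%:R^-1 < e.
    by have [k _ /(_ _ (leqnn k))] := near_infty_natSinv_lt (PosNum e0); exists k.
  have k0 : 0 < k.+1%:R^-1 :> R by rewrite invr_gt0.
  have /local_sup_leP/(_ Z CZ) := Fw k I.
  move=> /(_ (le_trans Zr _)); rewrite lerDl ltW // => /(_ isT) /le_trans; apply.
  rewrite mulrDl lerD2l ler_pdivrMr //; apply: (le_trans (ltW ke)).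
  by rewrite ler_peMr ?ler1n // ltW.
have F_cvg : P (F k) @[k --> \oo] --> P (\bigcap_k F k).
  apply: nonincreasing_cvg_mu => //.
  - by rewrite (le_lt_trans (probability_le1 _ _)) ?ltry //; exact: mE.
  - by move=> k; exact: mE.
  - by apply: bigcapT_measurable => k; exact: mE.
  - move=> k l kl; apply/subsetPset/E_mono; first by rewrite ltr_wpDr.
    by rewrite lerD2l lef_pV2 ?posrE // ler_nat.
rewrite -FE -(cvg_lim _ F_cvg) //; apply: lime_ge.
  by apply/cvg_ex; eexists; exact: F_cvg.
by apply: nearW => k; apply: PE; rewrite ltrDl invr_gt0.
Qed.

End RstarAttained.

Theorem theorem2 (R : realType) (d : measure_display) (T : measurableType d)
  (P : probability T R) (n : nat) (A : T -> 'M[R]_n) (C : set 'M[R]_n)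
  (Zs : 'M[R]_n) (hatZ : T -> 'M[R]_n) (G : 'M[R]_n -> R) (delta : R)
  (A_integrable : integrable_mx P A)
  (Zs_argmax : is_argmax C (mxdot (expectation_mx P A)) Zs)
  (hatZ_argmax : forall w, is_argmax C (mxdot (A w)) (hatZ w))
  (C_star : star_shaped_in C Zs)
  (delta_in01 : 0 < delta < 1)
  (rstar_gt0 : (0 < rstar P A C Zs G delta)%E)
  (local_curvature : forall Z, C Z ->
    ((G (Zs - Z))%:E <= rstar P A C Zs G delta)%E ->
    G (Zs - Z) <= mxdot (expectation_mx P A) (Zs - Z))
  (G_continuous : continuous G)
  (G0 : G 0 = 0)
  (G_scale : forall l : R, 0 <= l <= 1 -> forall Z, C Z ->
    G (l *: (Zs - Z)) <= l * G (Zs - Z)) :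
  holds_with_probability_at_least P (1 - delta)
    [set w | ((G (Zs - hatZ w))%:E <= rstar P A C Zs G delta)%E].
Proof.
have mW := measurable_centered_entry A_integrable.
(* Positivity excludes [-oo]; at [+oo] the conclusion holds on the whole space. *)
case rE : (rstar P A C Zs G delta) => [r| |]; last by rewrite rE in rstar_gt0.
- exists [set w |
    (local_sup C Zs G r (A w - expectation_mx P A)%R <= (r / 2)%:E)%E].
  have r0 : 0 < r by rewrite -lte_fin -rE.
  split; first exact: measurable_local_sup_le.
    move=> w /= supw; rewrite lee_fin.
    apply: (curvature_argmax_le C_star G_continuous G0 r0 _ (hatZ_argmax w) _ supw).
      by move=> Z CZ Zr; apply: local_curvature; rewrite // rE lee_fin.
    exact: Zs_argmax.1.
  exact: rstar_attained.
- exists [set: T]; split=> //; first by move=> w _ /=; rewrite leey.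
  by rewrite probability_setT lee_fin gerBl ltW // (andP delta_in01).1.
Qed.
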